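(* Let $k_\theta=\ell+2q$ denote the composite angular harmonic in the truncated harmonic expansion (A) of the near-field steering entry $a_{\rm NF}(r,\theta)[n]$ given in the context, and let $a_{n,q}[k]$ be the coefficients in the Fourier model (B) given in the context. Then, for every antenna index $n\in\{0,\dots,N_r-1\}$, there exists a deterministic matrix $\Phi_n\in\mathbb{C}^{N_u\times N_b}$ such that $$a_{\rm NF}(r,\theta)[n]\approx\big\langle \Phi_n,\ \phi_u(u(r))\,v(\theta)^{\mathsf H}\big\rangle .$$ One admissible construction is $$\Phi_n[k,m]=\sum_{\substack{|\ell|\le I_1,\ |q|\le I_2\\ \ell+2q=k_\theta(m)}} j^{\ell+q}\,J_\ell(k_\lambda n d)\,a_{n,q}[k],$$ where $k_\theta(m)\in\{-I_{\rm off},\dots,I_{\rm off}\}$ indexes the $m$th angular harmonic.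
   Context: Here $j$ is the imaginary unit and $J_\ell$ is the Bessel function of the first kind of integer order $\ell$. A uniform linear array has $N_r$ antennas with spacing $d=\lambda/2$, where $\lambda$ is the wavelength and $k_\lambda=2\pi/\lambda$. For a path of range $r$ and azimuth $\theta$, the exact spherical-wave steering entry at antenna $n$ is $$a_{\rm NF}(r,\theta)[n]=\exp\!\big(-jk_\lambda(r^{(n)}-r)\big),\qquad r^{(n)}=\sqrt{r^2+(nd)^2-2r(nd)\cos\theta}.$$ (A) Truncated harmonic expansion. With truncation levels $I_1,I_2$, a second-order Fresnel approximation followed by the Jacobi-Anger identity gives $$a_{\rm NF}(r,\theta)[n]\approx\sum_{\ell=-I_1}^{I_1}\sum_{q=-I_2}^{I_2} j^{\ell+q}J_\ell(k_\lambda nd)\,F_{n,q}(1/r)\,e^{j(\ell+2q)\theta},$$ where $F_{n,q}(x)=e^{-j\alpha_n x}J_q(\alpha_n x)$ and $\alpha_n=k_\lambda(nd)^2/4$. (B) Inverse-range Fourier model. For the range interval $[r_{\min},r_{\max}]$ put $x_{\min}=1/r_{\max}$, $x_{\max}=1/r_{\min}$, and $$u(r)=2\pi\,\frac{1/r-x_{\min}}{x_{\max}-x_{\min}}.$$ With $x=1/r$ and $u(x)$ denoting the same quantity written in terms of $x$, the coefficient functions are approximated by $$F_{n,q}(x)\approx\sum_{k=-K_u}^{K_u}a_{n,q}[k]\,e^{jku(x)}$$ with coefficients $a_{n,q}[k]\in\mathbb{C}$ (obtained by a weighted least-squares fit). Meaning of $\approx$: no error bound is given. The symbol $\approx$ in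 the claim refers to the approximation that results from using (A) and (B). Notation. $I_{\rm off}=I_1+2I_2$, $N_u=2K_u+1$, $N_b=2I_{\rm off}+1$. The steering vectors are $$\phi_u(u)=[e^{-jK_uu},\dots,e^{jK_uu}]^{\mathsf T}\in\mathbb{C}^{N_u},\qquad v(\theta)=[e^{-jI_{\rm off}\theta},\dots,e^{jI_{\rm off}\theta}]^{\mathsf T}\in\mathbb{C}^{N_b},$$ with entries written $\phi_u(u)[k]=e^{jku}$, $k\in\{-K_u,\dots,K_u\}$, and $v(\theta)[m]=e^{jk_\theta(m)\theta}$, $m\in\{1,\dots,N_b\}$. Rows of $N_u\times N_b$ matrices are indexed by $k$ and columns by $m$. Conventions, as the authors use them in deriving the statement: the pairing is $\langle\Phi_n,B\rangle=\sum_{k=-K_u}^{K_u}\sum_{m=1}^{N_b}\Phi_n[k,m]\,B[k,m]$, and the $(k,m)$th entry of the rank-one atom $\phi_u(u(r))\,v(\theta)^{\mathsf H}$ is taken, under the authors' ''adopted indexing convention'', to be $e^{jku(r)}e^{jk_\theta(m)\theta}$. *)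

(* Defs.v *)
From HB Require Import structures.
From mathcomp Require Import all_boot all_order all_algebra.
From mathcomp Require Import all_classical all_reals all_analysis.
From mathcomp Require Import complex.

Set Implicit Arguments.
Unset Strict Implicit.
Unset Printing Implicit Defensive.

Import Order.TTheory GRing.Theory Num.Theory.
Import numFieldNormedType.Exports.

Local Open Scope ring_scope.
Local Open Scope complex_scope.

(* e^{jt} for a real phase t *)
Definition cis (R : realType) (t : R) : R[i] := cos t +i* sin t.

(* Bessel functions of the first kind, by their power series
   J_n(x) = \sum_m (-1)^m / (m! (m+n)!) (x/2)^(2m+n) for n >= 0, and
   J_{-n} = (-1)^n J_n. *)
Definition besselJ_nat (R : realType) (n : nat) (x : R) : R :=
  limn (series (fun m : nat =>
    (-1) ^+ m / ((m`!)%:R * ((m + n)`!)%:R) * (x / 2) ^+ (2 * m + n))).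

Definition besselJ (R : realType) (l : int) (x : R) : R :=
  match l with
  | Posz n => besselJ_nat n x
  | Negz n => (-1) ^+ n.+1 * besselJ_nat n.+1 x
  end.

(* Ordinals below 2K+1 encode the integers -K, ..., K in increasing order. *)
Definition sym_idx (K : nat) (i : 'I_(2 * K).+1) : int := i%:Z - K%:Z.

Section Array.
Variables (R : realType) (lambda : R).

Definition klam : R := 2 * pi / lambda.
Definition spacing : R := lambda / 2.

Definition range_at (r theta : R) (n : nat) : R :=
  Num.sqrt (r ^+ 2 + (n%:R * spacing) ^+ 2
            - 2 * r * (n%:R * spacing) * cos theta).

Definition a_NF (r theta : R) (n : nat) : R[i] :=
  cis (- (klam * (range_at r theta n - r))).

Definition alpha (n : nat) : R := klam * (n%:R * spacing) ^+ 2 / 4.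

Definition F_coef (n : nat) (q : int) (x : R) : R[i] :=
  cis (- (alpha n * x)) * (besselJ q (alpha n * x))%:C.

(* The truncated harmonic expansion, with the functions of the inverse range
   left as a parameter G: G = F_coef n is the expansion itself, and any
   approximation of F_coef n can be inserted in its place. *)
Definition harmonic_expansion (I1 I2 n : nat) (G : int -> R -> R[i])
    (r theta : R) : R[i] :=
  \sum_(s < (2 * I1).+1) \sum_(t < (2 * I2).+1)
    let l := sym_idx s in
    let q := sym_idx t in
    'i ^ (l + q) * (besselJ l (klam * (n%:R * spacing)))%:C
    * G q (1 / r) * cis ((l + 2 * q)%:~R * theta).

End Array.

Section InverseRange.
Variables (R : realType) (rmin rmax : R).

Definition u_inv (x : R) : R :=
  2 * pi * ((x - 1 / rmax) / (1 / rmin - 1 / rmax)).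

Definition u_range (r : R) : R := u_inv (1 / r).

Definition fourier_model (Ku : nat) (c : int -> R[i]) (x : R) : R[i] :=
  \sum_(i < (2 * Ku).+1)
    c (sym_idx i) * cis ((sym_idx i)%:~R * u_inv x).

End InverseRange.

Definition Ioff (I1 I2 : nat) : nat := I1 + 2 * I2.

Definition phi_u (R : realType) (Ku : nat) (u : R) : 'cV[R[i]]_(2 * Ku).+1 :=
  \col_i cis ((sym_idx i)%:~R * u).

(* The harmonic of column m is k_theta(m) = sym_idx m. *)
Definition v_steer (R : realType) (I1 I2 : nat) (theta : R) :
    'cV[R[i]]_(2 * Ioff I1 I2).+1 :=
  \col_m cis ((sym_idx m)%:~R * theta).

(* The atom written phi_u v^H: under the indexing convention adopted for it, its
   (k, m) entry is e^{jku} e^{j k_theta(m) theta}, so v is not conjugated. *)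
Definition atom (R : realType) (Ku I1 I2 : nat) (u theta : R) :
    'M[R[i]]_((2 * Ku).+1, (2 * Ioff I1 I2).+1) :=
  phi_u Ku u *m (v_steer I1 I2 theta)^T.

(* Bilinear: no conjugation on either argument. *)
Definition pairing (R : realType) (p q : nat) (A B : 'M[R[i]]_(p, q)) : R[i] :=
  \sum_(i < p) \sum_(j < q) A i j * B i j.

Definition Phi_harmonic (R : realType) (lambda : R) (I1 I2 Ku n : nat)
    (a : int -> int -> R[i]) :
    'M[R[i]]_((2 * Ku).+1, (2 * Ioff I1 I2).+1) :=
  \matrix_(i, m)
    \sum_(s < (2 * I1).+1)
      \sum_(t < (2 * I2).+1 | sym_idx s + 2 * sym_idx t == sym_idx m)
        'i ^ (sym_idx s + sym_idx t)
        * (besselJ (sym_idx s) (klam lambda * (n%:R * spacing lambda)))%:C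
        * a (sym_idx t) (sym_idx i).

(* g is the approximation of a_NF(., .)[n] that results from the truncated
   harmonic expansion followed by the Fourier models of the F_{n,q}, whose
   coefficients are a q k. First, g is the harmonic expansion with each F_{n,q}
   replaced by its Fourier model. Second, it approximates a_NF as well as the
   two steps allow: if at (r, theta) the expansion is accurate to within eA and
   the Fourier models to within eB q, then g is accurate to within the
   accumulated error. *)
Definition approximates_a_NF (R : realType) (lambda rmin rmax : R)
    (I1 I2 Ku n : nat) (a : int -> int -> R[i]) (g : R -> R -> R[i]) : Prop :=
  forall r theta : R, rmin <= r <= rmax ->
    let Fhat q := fourier_model rmin rmax Ku (a q) in
    g r theta = harmonic_expansion lambda I1 I2 n Fhat r theta
    /\ forall (eA : R) (eB : int -> R),
      `|a_NF lambda r theta n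
        - harmonic_expansion lambda I1 I2 n (F_coef lambda n) r theta|
        <= eA%:C ->
      (forall q : int, `|q| <= I2%:Z ->
        `|F_coef lambda n q (1 / r) - Fhat q (1 / r)| <= (eB q)%:C) ->
      `|a_NF lambda r theta n - g r theta|
        <= (eA + \sum_(s < (2 * I1).+1) \sum_(t < (2 * I2).+1)
              `|besselJ (sym_idx s) (klam lambda * (n%:R * spacing lambda))|
              * eB (sym_idx t))%:C.

(* Main.v *)
(* Substituting the Fourier models into the harmonic expansion and grouping the
   pairs (l, q) by their composite harmonic l + 2q, which always lies in
   [-Ioff, Ioff], gives the pairing with the atom. Since the exponentials are
   unimodular, an error eB q in the model of F_{n,q} contributes at most
   |J_l| eB q for each pair (l, q). *)

Require Import Defs.
From HB Require Import structures.
From mathcomp Require Import all_boot all_order all_algebra.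
From mathcomp Require Import all_classical all_reals all_analysis.
From mathcomp Require Import complex.
From mathcomp Require Import zify.

Set Implicit Arguments.
Unset Strict Implicit.
Unset Printing Implicit Defensive.

Import Order.TTheory GRing.Theory Num.Theory.
Import numFieldNormedType.Exports.

Local Open Scope ring_scope.
Local Open Scope complex_scope.

Lemma normr_cis (R : realType) (t : R) : `|cis t| = 1.
Proof. by rewrite normc_def /= cos2Dsin2 sqrtr1. Qed.

Lemma normr_exprz_i (R : realType) (z : int) : `|'i%C ^ z : R[i]| = 1.
Proof.
have n1 : `|'i%C : R[i]| = 1 by rewrite normc_def /= expr0n expr1n add0r sqrtr1.
have nX k : `|'i%C ^+ k : R[i]| = 1 by rewrite normrX n1 expr1n.
by case: z => k; rewrite -?exprnP ?NegzE -?exprnN ?normfV ?nX ?invr1.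
Qed.

Lemma normr_real_complex (R : realType) (x : R) : `|x%:C| = `|x|%:C.
Proof. by rewrite normc_def /= expr0n addr0 sqrtr_sqr. Qed.

Lemma ler_norm_real_complexM (R : realType) (x e : R) (z : R[i]) :
  `|z| <= e%:C -> `|x%:C * z| <= (`|x| * e)%:C.
Proof.
move=> ze; have -> : (`|x| * e)%:C = `|x|%:C * e%:C by rewrite -rmorphM.
by rewrite normrM normr_real_complex ler_wpM2l // lecR.
Qed.

Lemma sym_idx_inj (K : nat) : injective (@sym_idx K).
Proof. by move=> i j /addIr [/val_inj]. Qed.

Lemma normz_sym_idx (K : nat) (i : 'I_(2 * K).+1) : `|sym_idx i| <= K%:Z.
Proof. by case: i => i ilt; rewrite /sym_idx /=; lia. Qed.

Lemma sym_idx_surj (K : nat) (z : int) :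
  `|z| <= K%:Z -> exists i : 'I_(2 * K).+1, sym_idx i = z.
Proof.
(* The inverse of [sym_idx] is the shift by [K]; [absz] changes nothing, since [z + K] is
   nonnegative. *)
move=> zK; have lt : (absz (z + K%:Z)%R < (2 * K).+1)%N by lia.
by exists (Ordinal lt); rewrite /sym_idx /=; lia.
Qed.

(** Provides the column in which the pair (l, q) is collected; it is unique by [sym_idx_inj]. *)
Lemma composite_harmonic (I1 I2 : nat)
    (s : 'I_(2 * I1).+1) (t : 'I_(2 * I2).+1) :
  exists m : 'I_(2 * Ioff I1 I2).+1, sym_idx m = sym_idx s + 2 * sym_idx t.
Proof.
apply: sym_idx_surj; move: (normz_sym_idx s) (normz_sym_idx t).
by rewrite /Ioff; lia.
Qed.

Lemma pairing_Phi_harmonic (R : realType) (lambda rmin rmax : R)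
    (I1 I2 Ku n : nat) (a : int -> int -> R[i]) (r theta : R) :
  pairing (Phi_harmonic lambda I1 I2 Ku n a)
    (atom Ku I1 I2 (u_range rmin rmax r) theta)
  = harmonic_expansion lambda I1 I2 n
      (fun q => fourier_model rmin rmax Ku (a q)) r theta.
Proof.
rewrite /pairing /harmonic_expansion.
(* Common form of both sides: a triple sum over k, l, q, in which the column index m has been
   eliminated. *)
transitivity (\sum_(i < (2 * Ku).+1) \sum_(s < (2 * I1).+1)
    \sum_(t < (2 * I2).+1)
    'i%C ^ (sym_idx s + sym_idx t)
    * (besselJ (sym_idx s) (klam lambda * (n%:R * spacing lambda)))%:C
    * a (sym_idx t) (sym_idx i)
    * (cis ((sym_idx i)%:~R * u_range rmin rmax r)
       * cis ((sym_idx s + 2 * sym_idx t)%:~R * theta))).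
  apply: eq_bigr => i _.
  under eq_bigr => m _.
    rewrite !mxE big_ord1 !mxE mulr_suml.
    (* The constraint on q depends on m; as a conditional summand it lets the sum over m move
       innermost. *)
    under eq_bigr => s _ do rewrite mulr_suml big_mkcond.
    over.
  rewrite exchange_big; apply: eq_bigr => s _.
  rewrite exchange_big; apply: eq_bigr => t _ /=.
  (* For fixed (l, q) exactly one column m contributes. *)
  have [m mE] := composite_harmonic s t.
  rewrite (bigD1 m) //= mE eqxx big1 ?addr0 // => m' m'm.
  by rewrite -mE (inj_eq (@sym_idx_inj _)) eq_sym (negPf m'm).
(* With k innermost, the sum over k is the Fourier model of F_{n,q}. *)
rewrite exchange_big; apply: eq_bigr => s _.
rewrite exchange_big; apply: eq_bigr => t _ /=.
rewrite /fourier_model mulr_sumr mulr_suml; apply: eq_bigr => i _.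
by rewrite /u_range !mulrA.
Qed.

Lemma harmonic_expansion_dist (R : realType) (lambda : R) (I1 I2 n : nat)
    (G H : int -> R -> R[i]) (r theta : R) (eB : int -> R) :
  (forall q : int, `|q| <= I2%:Z ->
    `|G q (1 / r) - H q (1 / r)| <= (eB q)%:C) ->
  `|harmonic_expansion lambda I1 I2 n G r theta
    - harmonic_expansion lambda I1 I2 n H r theta|
  <= (\sum_(s < (2 * I1).+1) \sum_(t < (2 * I2).+1)
        `|besselJ (sym_idx s) (klam lambda * (n%:R * spacing lambda))|
        * eB (sym_idx t))%:C.
Proof.
move=> GH; rewrite /harmonic_expansion -sumrB rmorph_sum /=.
apply: le_trans (ler_norm_sum _ _ _) _; apply: ler_sum => s _.
rewrite -sumrB rmorph_sum /=.
apply: le_trans (ler_norm_sum _ _ _) _; apply: ler_sum => t _.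
(* The two summands differ only in the factor [G] or [H]; of the common factors, only J_l has a
   modulus other than 1 in general. *)
rewrite -mulrBl -mulrBr normrM normr_cis mulr1 -mulrA normrM normr_exprz_i.
rewrite [1 * `|_|]mul1r; apply: ler_norm_real_complexM.
exact/GH/normz_sym_idx.
Qed.

Theorem proposition1 (R : realType) (lambda rmin rmax : R)
    (Nr I1 I2 Ku : nat) (a : 'I_Nr -> int -> int -> R[i])
    (hlambda : 0 < lambda) (hrmin : 0 < rmin) (hr : rmin < rmax) :
  forall n : 'I_Nr,
    (exists Phi : 'M[R[i]]_((2 * Ku).+1, (2 * Ioff I1 I2).+1),
       approximates_a_NF lambda rmin rmax I1 I2 Ku n (a n)
         (fun r theta => pairing Phi (atom Ku I1 I2 (u_range rmin rmax r) theta)))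
    /\ approximates_a_NF lambda rmin rmax I1 I2 Ku n (a n)
         (fun r theta => pairing (Phi_harmonic lambda I1 I2 Ku n (a n))
                           (atom Ku I1 I2 (u_range rmin rmax r) theta)).
Proof.
move=> n.
suff PhiP : approximates_a_NF lambda rmin rmax I1 I2 Ku n (a n)
    (fun r theta => pairing (Phi_harmonic lambda I1 I2 Ku n (a n))
                      (atom Ku I1 I2 (u_range rmin rmax r) theta)).
  by split=> //; exists (Phi_harmonic lambda I1 I2 Ku n (a n)).
move=> r theta _ Fhat; split=> [|eA eB hA hB].
  exact: pairing_Phi_harmonic.
rewrite pairing_Phi_harmonic rmorphD.
(* Triangle inequality through the expansion with the exact F_{n,q}: the first leg costs [eA], the
   second the weighted sum of the [eB q]. *)
apply: le_trans (ler_distD _ _ _) (lerD hA _).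
exact: harmonic_expansion_dist.
Qed.
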